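(* Let $\mu$ be a probability measure on $\mathbb{C}$ with $\int|z|^n\,d\mu<\infty$ for all $n$, and let $\Phi_n$ be its monic orthogonal polynomials. Suppose $z_0$ is a pure point of $\mu$ and $\delta=\mathrm{dist}\bigl(z_0,\mathrm{cvh}(\mathrm{supp}(\mu)\setminus\{z_0\})\bigr)>0$. Then each $\Phi_n$ has at most one zero in $\{z:|z-z_0|<\delta/2\}$.
   Context: $\Phi_n$ is the monic polynomial of degree $n$ orthogonal in $L^2(\mathbb{C},d\mu)$ to all polynomials of degree less than $n$ (defined whenever $\mathrm{supp}\,\mu$ has at least $n$ points). $\mathrm{cvh}$ denotes convex hull. *)

(* Defs.v *)
(* mathcomp-analysis (measures, integrals) + real_closed complex numbers. *)
From HB Require Import structures.
From mathcomp Require Import all_boot all_order all_algebra.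
From mathcomp Require Import all_classical all_reals all_analysis.
From mathcomp Require Import complex.

Set Implicit Arguments.
Unset Strict Implicit.
Unset Printing Implicit Defensive.

Import Order.TTheory GRing.Theory Num.Theory.
Local Open Scope classical_set_scope.
Local Open Scope ring_scope.
Local Open Scope complex_scope.

(* The complex plane C is modelled as R[i]; a measure on C is a measure on the
   measurable space R * R (product Borel sigma-algebra = Borel sets of C),
   transported along the identification (x, y) |-> x + i y. *)

Definition toC (R : realType) (p : (R * R)%type) : R[i] := Complex p.1 p.2.

(* modulus |z| as a real number *)
Definition cabs (R : realType) (z : R[i]) : R :=
  Num.sqrt (complex.Re z ^+ 2 + complex.Im z ^+ 2).

(* integral of a complex-valued function: integral of real part + i * integral of imaginary part *)
Definition cint (R : realType) (mu : probability (R * R)%type R)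
  (f : (R * R)%type -> R[i]) : R[i] :=
  Complex (Rintegral mu setT (fun x => complex.Re (f x)))
          (Rintegral mu setT (fun x => complex.Im (f x))).

(* L^2(mu) inner product of polynomials: <p, q> = int p(z) conj(q(z)) dmu(z) *)
Definition pinner (R : realType) (mu : probability (R * R)%type R)
  (p q : {poly R[i]}) : R[i] :=
  cint mu (fun x => p.[toC x] * (q.[toC x])^*).

(* the (closed) support of mu: points all of whose open discs have positive measure *)
Definition csupp (R : realType) (mu : probability (R * R)%type R) : set R[i] :=
  [set z : R[i] | forall e : R, 0 < e ->
     (0 < mu (@toC R @^-1` [set w : R[i] | (cabs (w - z) < e)%R]))%E].

(* convex hull of a subset of C: all finite convex combinations *)
Definition cvh (R : realType) (S : set R[i]) : set R[i] :=
  [set w | exists (k : nat) (c : 'I_k -> R) (s : 'I_k -> R[i]),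
     (forall i, 0 <= c i) /\ \sum_(i < k) c i = 1 /\ (forall i, S (s i)) /\
     w = \sum_(i < k) (c i)%:C * s i].

(* p is a (the) monic orthogonal polynomial of degree n for mu *)
Definition is_monic_OP (R : realType) (mu : probability (R * R)%type R)
  (n : nat) (p : {poly R[i]}) : Prop :=
  p \is monic /\ size p = n.+1 /\
  forall q : {poly R[i]}, (size q <= n)%N -> pinner mu p q = 0.

(* Main.v *)
Require Import Defs.
From HB Require Import structures.
From mathcomp Require Import all_boot all_order all_algebra.
From mathcomp Require Import all_classical all_reals all_analysis.
From mathcomp Require Import measurable_realfun complex.
From mathcomp Require Import ring lra.

Import Order.TTheory GRing.Theory Num.Theory.
Import numFieldNormedType.Exports.
Local Open Scope classical_set_scope.
Local Open Scope ring_scope.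
Local Open Scope complex_scope.

(* Suppose Phi = (z - z1) (z - z2) p with both zeros within delta / 2 of z0.
   Separating z0 from the convex hull of the rest of the support gives a unit v
   with Re ((s - z0) conj v) >= delta for every other support point s.  Testing the
   orthogonality of Phi against v (z - z0) p yields
     int Re ((z - z1) (z - z2) conj (v (z - z0))) |p|^2 dmu = 0.
   The point z0 does not contribute, and at every other support point the factor
   in front of |p|^2 is positive, so (z - z0) p vanishes on the support of mu.
   This polynomial has degree n - 1, but the support has at least n points. *)

(** * Real-valued modulus and real parts on [R[i]] *)

Section ComplexModulus.
Variable R : realType.
Implicit Types z w : R[i].

Lemma cabs_normc z : (cabs z)%:C = `|z|.
Proof. by rewrite normc_def. Qed.

Lemma cabs_ge0 z : 0 <= cabs z.
Proof. exact: sqrtr_ge0. Qed.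

Lemma sqr_cabs z : cabs z ^+ 2 = complex.Re z ^+ 2 + complex.Im z ^+ 2.
Proof. by rewrite sqr_sqrtr // addr_ge0 // sqr_ge0. Qed.

Lemma cabsM z w : cabs (z * w) = cabs z * cabs w.
Proof. by apply: complexI; rewrite rmorphM /= !cabs_normc normrM. Qed.

Lemma cabsD z w : cabs (z + w) <= cabs z + cabs w.
Proof. by rewrite -lecR rmorphD /= !cabs_normc ler_normD. Qed.

Lemma cabsN z : cabs (- z) = cabs z.
Proof. by apply: complexI; rewrite !cabs_normc normrN. Qed.

Lemma cabsJ z : cabs (z^*)%R = cabs z.
Proof. by apply: complexI; rewrite !cabs_normc normcJ. Qed.

Lemma cabs0 : cabs (0 : R[i]) = 0.
Proof. by apply: complexI; rewrite cabs_normc normr0. Qed.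

Lemma cabs_eq0 z : (cabs z == 0) = (z == 0).
Proof. by rewrite -(inj_eq (@complexI R)) cabs_normc normr_eq0. Qed.

Lemma ler_Re_cabs z : `|complex.Re z| <= cabs z.
Proof. by rewrite -lecR cabs_normc normc_ge_Re. Qed.

Lemma complex_real_def z : z = complex.Re z +i* complex.Im z.
Proof. by case: z. Qed.

Lemma ReB z w : complex.Re (z - w) = complex.Re z - complex.Re w.
Proof. by case: z w => [? ?] []. Qed.

Lemma ImB z w : complex.Im (z - w) = complex.Im z - complex.Im w.
Proof. by case: z w => [? ?] []. Qed.

Lemma Re_mulJ z w : complex.Re (z * w^*) =
  complex.Re z * complex.Re w + complex.Im z * complex.Im w.
Proof. by case: z w => [? ?] [? ?] /=; ring. Qed.

Lemma Re_mul_real (z : R[i]) (r : R) :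
  complex.Re (z * r%:C) = complex.Re z * r.
Proof. by case: z => a b /=; rewrite mulr0 subr0. Qed.

Lemma cabs_le_ReIm (z : R[i]) : cabs z <= `|complex.Re z| + `|complex.Im z|.
Proof.
rewrite -(@ler_pXn2r _ 2) ?nnegrE ?cabs_ge0 ?addr_ge0 // sqr_cabs sqrrD.
rewrite !real_normK ?num_real // -addrA lerD2l lerDr.
by rewrite mulrn_wge0 // mulr_ge0.
Qed.

End ComplexModulus.

(** * Positivity of the test kernel on a half-plane *)

Section HalfPlane.
Variable R : realType.

(* The last step is Cauchy-Schwarz for (y, b2) weighted by (1, 3), followed by
   (b1 - r) (b1 - 2 r) >= 0. *)
Lemma half_plane_dist (r x y b1 b2 : R) : 0 < r -> r *+ 2 <= x ->
  b1 ^+ 2 + b2 ^+ 2 <= r ^+ 2 ->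
  r ^+ 2 * ((x - b1) ^+ 2 + (y - b2) ^+ 2) <= (x ^+ 2 + y ^+ 2) * (x - b1) ^+ 2.
Proof.
move=> r0 rx br.
have b1r : b1 <= r by nra.
have x2 : 3 * r ^+ 2 + y ^+ 2 <= x ^+ 2 + y ^+ 2 - r ^+ 2 by nra.
have xb : r ^+ 2 + b2 ^+ 2 / 3 <= (x - b1) ^+ 2.
  have : (2 * r - b1) ^+ 2 <= (x - b1) ^+ 2 by nra.
  have : 0 <= (b1 - r) * (b1 - 2 * r) by nra.
  by nra.
suff : r ^+ 2 * (y - b2) ^+ 2 <= (x ^+ 2 + y ^+ 2 - r ^+ 2) * (x - b1) ^+ 2.
  by move=> h; lra.
apply: (@le_trans _ _ ((3 * r ^+ 2 + y ^+ 2) * (r ^+ 2 + b2 ^+ 2 / 3))).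
  rewrite -subr_ge0.
  have -> : (3 * r ^+ 2 + y ^+ 2) * (r ^+ 2 + b2 ^+ 2 / 3) -
            r ^+ 2 * (y - b2) ^+ 2 = (3 * r ^+ 2 + y * b2) ^+ 2 / 3 by field.
  by rewrite divr_ge0 // sqr_ge0.
have sq t : 0 <= t ^+ 2 :> R by exact: sqr_ge0.
by apply: ler_pM => //; have := sq r; have := sq y; have := sq b2; lra.
Qed.

(** With u = x + iy and w = (u - b) conj u, the real part equals |u|^2 Re (u - b) - Re (a w).
    Cauchy-Schwarz gives |Re (a w)| <= |a| |u| |u - b|, and since |a| < r, [half_plane_dist] puts
    this strictly below |u|^2 Re (u - b). *)
Lemma half_plane_pos (r x y a1 a2 b1 b2 : R) : 0 < r -> r *+ 2 <= x ->
  a1 ^+ 2 + a2 ^+ 2 < r ^+ 2 -> b1 ^+ 2 + b2 ^+ 2 <= r ^+ 2 ->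
  0 < complex.Re (((x - a1) +i* (y - a2)) * ((x - b1) +i* (y - b2)) *
                  (x -i* y)).
Proof.
move=> r0 rx ar br.
have D := @half_plane_dist r x y b1 b2 r0 rx br.
pose N := x ^+ 2 + y ^+ 2; pose M := (x - b1) ^+ 2 + (y - b2) ^+ 2.
pose w1 := (x - b1) * x + (y - b2) * y; pose w2 := (y - b2) * x - (x - b1) * y.
have NM : w1 ^+ 2 + w2 ^+ 2 = N * M by rewrite /w1 /w2 /N /M; ring.
have b1r : b1 <= r by nra.
have xb0 : 0 < x - b1 by nra.
have x0 : 0 < x by lra.
have N0 : 0 < N by rewrite ltr_pwDl ?exprn_gt0 ?sqr_ge0.
have M0 : 0 < M by rewrite ltr_pwDl ?exprn_gt0 ?sqr_ge0.
have -> : complex.Re (((x - a1) +i* (y - a2)) * ((x - b1) +i* (y - b2)) *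
                  (x -i* y)) = N * (x - b1) - (a1 * w1 - a2 * w2).
  by rewrite /N /w1 /w2 /=; ring.
have CS : (a1 * w1 - a2 * w2) ^+ 2 <= (a1 ^+ 2 + a2 ^+ 2) * (N * M).
  rewrite -NM -subr_ge0.
  have -> : (a1 ^+ 2 + a2 ^+ 2) * (w1 ^+ 2 + w2 ^+ 2) - (a1 * w1 - a2 * w2) ^+ 2
    = (a1 * w2 + a2 * w1) ^+ 2 by ring.
  exact: sqr_ge0.
rewrite subr_gt0.
have P0 : 0 <= N * (x - b1) by rewrite mulr_ge0 // ltW.
apply: (le_lt_trans (ler_norm _)).
rewrite -(ltr_pXn2r (n := 2)) // ?nnegrE // real_normK ?num_real //.
apply: (le_lt_trans CS); rewrite exprMn.
have -> : (a1 ^+ 2 + a2 ^+ 2) * (N * M) = N * ((a1 ^+ 2 + a2 ^+ 2) * M) by ring.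
rewrite expr2 -mulrA ltr_pM2l //; apply: lt_le_trans D.
by rewrite ltr_pM2r.
Qed.

(** Multiplying [u], [a] and [b] by conj v turns the direction [v] into 1. The product only gains
    the factor v conj v = 1, so [half_plane_pos] applies with r = d / 2. *)
Lemma rotated_half_plane_pos (d : R) (u v a b : R[i]) : 0 < d -> cabs v = 1 ->
  d <= complex.Re (u * v^*) -> cabs a < d / 2 -> cabs b < d / 2 ->
  0 < complex.Re ((u - a) * (u - b) * (v * u)^*).
Proof.
move=> d0 v1 ud ad bd.
have vv : v * v^* = 1 by rewrite -sqr_normc -cabs_normc v1 expr1n.
have -> : (u - a) * (u - b) * (v * u)^* =
  (u * v^* - a * v^*) * (u * v^* - b * v^*) * (u * v^*)^*.
  have -> : (u * v^* - a * v^*) * (u * v^* - b * v^*) * (u * v^*)^* =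
    (v * v^*) * ((u - a) * (u - b) * (v * u)^*).
    by rewrite !rmorphM /= conjCK; ring.
  by rewrite vv mul1r.
have bound (c : R[i]) : cabs c < d / 2 ->
    complex.Re (c * v^*) ^+ 2 + complex.Im (c * v^*) ^+ 2 < (d / 2) ^+ 2.
  move=> cd; rewrite -sqr_cabs cabsM cabsJ v1 mulr1.
  by rewrite ltr_pXn2r // nnegrE ?cabs_ge0 // ltW // divr_gt0.
have := bound _ ad; have := bound _ bd.
move: (u * v^*) (a * v^*) (b * v^*) ud => [x y] [a1 a2] [b1 b2] /= ud hb ha.
by apply: (@half_plane_pos (d / 2)) => //; [lra | lra | exact: ltW].
Qed.

End HalfPlane.

(** * Convex hulls, nearest points and separation *)

Section Separation.
Variable R : realType.
Implicit Types (S : set R[i]) (w s z : R[i]).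

Lemma sub_cvh S : S `<=` cvh S.
Proof.
move=> s Ss; exists 1%N, (fun=> 1), (fun=> s); split=> [_|]; first exact: ler01.
by rewrite !big_ord1 mul1r.
Qed.

(** The point [s] is prepended with weight [t], and the old weights are scaled by [1 - t]. *)
Lemma cvh_segment S w s (t : R) : 0 <= t <= 1 -> cvh S w -> S s ->
  cvh S ((1 - t)%:C * w + t%:C * s).
Proof.
move=> /andP[t0 t1] [k [c [a [c0 [c1 [Sa ->]]]]]] Ss.
exists k.+1, (fun i => if unlift ord0 i is Some j then (1 - t) * c j else t).
exists (fun i => if unlift ord0 i is Some j then a j else s).
split; [|split; [|split]].
- by move=> i; case: unliftP => [j _|_] //; rewrite mulr_ge0 // subr_ge0.
- rewrite big_ord_recl unlift_none.
  under eq_bigr do rewrite liftK.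
  by rewrite -mulr_sumr c1 mulr1 addrC subrK.
- by move=> i; case: unliftP.
- rewrite big_ord_recl !unlift_none addrC; congr (_ + _).
  rewrite mulr_sumr; apply: eq_bigr => i _.
  by rewrite liftK rmorphM /= mulrA.
Qed.

(** This extracts the first-order condition at a minimum along a segment. *)
Lemma le0_of_quadratic_bound (k h : R) : 0 <= h ->
  (forall t : R, 0 <= t <= 1 -> t * k *+ 2 <= t ^+ 2 * h) -> k <= 0.
Proof.
move=> h0 H; rewrite leNgt; apply/negP => k0.
have kh : 0 < k + h by rewrite ltr_wpDr.
(* This [t] lies in (0, 1] and satisfies t h = k - t k < k, while the hypothesis divided by [t]
   gives 2 k <= t h. *)
pose t := k / (k + h).
have tkh : t * (k + h) = k by rewrite divfK // gt_eqF.
have t0 : 0 < t by rewrite divr_gt0.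
have t1 : t <= 1 by nra.
have := H t; rewrite (ltW t0) t1 => /(_ isT).
have -> : t * k *+ 2 = t * (k *+ 2) by rewrite mulrnAr.
have -> : t ^+ 2 * h = t * (t * h) by rewrite expr2 mulrA.
by rewrite ler_pM2l //; nra.
Qed.

(** Squaring keeps the distance polynomial in the coordinates; the argument is a pair because
    closure and compactness are taken in [R * R]. *)
Definition sqdist (z : R[i]) (p : R * R) : R :=
  (p.1 - complex.Re z) ^+ 2 + (p.2 - complex.Im z) ^+ 2.

Lemma continuous_sqdist z : continuous (sqdist z).
Proof.
move=> p; apply: cvgD; rewrite /GRing.exp /=.
  by apply: cvgM; (apply: cvgB; [exact: cvg_fst | exact: cvg_cst]).
by apply: cvgM; (apply: cvgB; [exact: cvg_snd | exact: cvg_cst]).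
Qed.

Lemma sqdistE z p : sqdist z p = cabs (z - toC p) ^+ 2.
Proof. by rewrite sqr_cabs /sqdist; case: z => a b /=; ring. Qed.

Lemma nearest_point_closed (K : set (R * R)) z : closed K -> K !=set0 ->
  exists2 c, K c & forall p, K p -> sqdist z c <= sqdist z p.
Proof.
move=> clK [s Ks].
have f0 : 0 <= sqdist z s by rewrite addr_ge0 // sqr_ge0.
(* The added 1 avoids a square root: q^2 <= D already forces |q| <= D + 1. *)
pose M := sqdist z s + 1.
pose B := `[complex.Re z - M, complex.Re z + M] `*`
          `[complex.Im z - M, complex.Im z + M].
have inB p : sqdist z p <= sqdist z s -> B p.
  move: f0; rewrite /B /M; move: (sqdist z s) => D D0 pD.
  have box (q : R) : q ^+ 2 <= D -> - (D + 1) <= q <= D + 1.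
    by move=> qD; apply/andP; split; nra.
  have /box/andP[? ?] : (p.1 - complex.Re z) ^+ 2 <= D.
    by apply: le_trans pD; rewrite lerDl sqr_ge0.
  have /box/andP[? ?] : (p.2 - complex.Im z) ^+ 2 <= D.
    by apply: le_trans pD; rewrite lerDr sqr_ge0.
  by split; rewrite /= in_itv /=; apply/andP; split; lra.
have cB : compact B by apply: compact_setX; exact: segment_compact.
have cK : compact (K `&` B).
  apply: (subclosed_compact _ cB) => //; apply: closedI => //.
  by apply: compact_closed => //; exact: norm_hausdorff.
have Bs : B s by exact: inB.
have [c] := @compact_EVT_min _ R (sqdist z) (K `&` B)
  (ex_intro _ s (conj Ks Bs)) cK (continuous_subspaceT (@continuous_sqdist z)).
rewrite inE => -[Kc Bc] cmin; exists c => // p Kp.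
(* A point of [K] outside the box is farther from [z] than [s] is, so the minimum over the compact
   part is global. *)
have [Bp|nBp] := pselect (B p); first by apply: cmin; rewrite inE.
apply: (@le_trans _ _ (sqdist z s)); first by apply: cmin; rewrite inE.
by rewrite leNgt; apply/negP => /ltW/inB.
Qed.

(** The vector [v] points from [z] to the nearest point [c] of the closed hull; the line through [c]
    orthogonal to [v] has [S] on its far side. *)
Lemma convex_hull_separation S z (d : R) : 0 < d ->
  (forall w, cvh S w -> d <= cabs (z - w)) ->
  exists2 v, cabs v = 1 & forall s, S s -> d <= complex.Re ((s - z) * v^*).
Proof.
move=> d0 hd.
(* For empty [S] there is no nearest point, and any unit vector will do. *)
have [S0|/set0P[s0 Ss0]] := eqVneq S set0.
  exists 1; first by apply: complexI; rewrite cabs_normc normr1.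
  by move=> s; rewrite S0.
pose H := [set p : R * R | cvh S (toC p)].
have toCK w : toC (complex.Re w, complex.Im w) = w by case: w.
have Ks0 : closure H (complex.Re s0, complex.Im s0).
  by apply: subset_closure; rewrite /H /= toCK; exact: sub_cvh.
have [c Kc cmin] := @nearest_point_closed (closure H) z
  (@closed_closure _ H) (ex_intro _ _ Ks0).
(* The bound is known on the hull and passes to its closure by continuity. *)
have dc : d ^+ 2 <= sqdist z c.
  have : closed (sqdist z @^-1` [set x | d ^+ 2 <= x]).
    apply: closed_comp => [p _|]; last exact: closed_ge.
    exact: continuous_sqdist.
  move=> /closure_id E; move: Kc.
  suff : H `<=` sqdist z @^-1` [set x | d ^+ 2 <= x].
    by move=> /closure_subset HE /HE; rewrite -E.
  move=> p /hd /= dp; rewrite sqdistE.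
  by rewrite ler_pXn2r ?nnegrE ?cabs_ge0 // ltW.
pose e1 := c.1 - complex.Re z; pose e2 := c.2 - complex.Im z.
have ee : sqdist z c = e1 ^+ 2 + e2 ^+ 2 by [].
(* Moving from [c] towards [s] cannot decrease the distance to [z], so the derivative of [sqdist] at
   t = 0 is nonnegative. *)
have obtuse s : S s ->
    0 <= e1 * (complex.Re s - c.1) + e2 * (complex.Im s - c.2).
  move=> Ss; rewrite -oppr_le0.
  apply: (@le0_of_quadratic_bound _
    ((complex.Re s - c.1) ^+ 2 + (complex.Im s - c.2) ^+ 2)).
    by rewrite addr_ge0 // sqr_ge0.
  move=> t t01.
  pose g (p : R * R) : R * R :=
    ((1 - t) * p.1 + t * complex.Re s, (1 - t) * p.2 + t * complex.Im s).
  have cg : continuous g.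
    move=> p.
    have c1 : (1 - t) * q.1 + t * complex.Re s @[q --> p] --> (g p).1.
      apply: cvgD; last exact: cvg_cst.
      by apply: cvgM; [exact: cvg_cst | exact: cvg_fst].
    have c2 : (1 - t) * q.2 + t * complex.Im s @[q --> p] --> (g p).2.
      apply: cvgD; last exact: cvg_cst.
      by apply: cvgM; [exact: cvg_cst | exact: cvg_snd].
    exact: cvg_pair c1 c2.
  (* The map [g] sends the hull into itself and is continuous, so it preserves the closure. *)
  have gK : closure H (g c).
    have : closed (g @^-1` closure H).
      by apply: closed_comp => [p _|]; [exact: cg | exact: closed_closure].
    move=> /closure_id E; move: Kc; suff : H `<=` g @^-1` closure H.
      by move=> /closure_subset HE /HE; rewrite -E.
    move=> p Hp; apply: subset_closure; rewrite /H /=.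
    have -> : toC (g p) = (1 - t)%:C * toC p + t%:C * s.
      by rewrite /toC /= [X in _ = _ + _ * X]complex_real_def; simpc.
    exact: cvh_segment.
  have := cmin _ gK; rewrite /sqdist /g /= /e1 /e2.
  by nra.
pose n := Num.sqrt (sqdist z c).
have n0 : 0 < n by rewrite sqrtr_gt0; apply: lt_le_trans dc; exact: exprn_gt0.
have nn : n ^+ 2 = sqdist z c.
  by rewrite sqr_sqrtr //; apply: le_trans dc; exact: sqr_ge0.
have dn : d <= n by rewrite -(@ler_pXn2r _ 2) ?nnegrE ?nn // ltW.
exists (e1 / n +i* (e2 / n)).
  apply/eqP; rewrite -(@eqrXn2 _ 2) ?cabs_ge0 // sqr_cabs /= expr1n.
  by rewrite !expr_div_n -mulrDl -ee -nn divff // sqrf_eq0 gt_eqF.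
move=> s /obtuse os.
(* Writing s - z = (c - z) + (s - c), the numerator is n^2 plus the nonnegative term from [obtuse],
   so the quotient is at least [n]. *)
have -> : complex.Re ((s - z) * (e1 / n +i* (e2 / n))^*) =
  (e1 * (complex.Re s - complex.Re z) + e2 * (complex.Im s - complex.Im z)) / n.
  by rewrite Re_mulJ ReB ImB /=; ring.
apply: (le_trans dn); rewrite ler_pdivlMr // -expr2 nn ee.
by move: os; rewrite /e1 /e2; lra.
Qed.

End Separation.

(** * The support carries full measure *)

Section Support.
Variable R : realType.
Variable mu : probability (R * R)%type R.

Definition disc (z : R[i]) (e : R) : set (R * R) :=
  @toC R @^-1` [set w | cabs (w - z) < e].

Lemma measurable_cabsB (z : R[i]) :
  measurable_fun setT (fun x : R * R => cabs (toC x - z)).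
Proof.
apply: (@measurableT_comp _ _ _ _ _ _ (@Num.sqrt R)).
  by apply: continuous_measurable_fun; exact: sqrt_continuous.
have -> : (fun x : R * R =>
    complex.Re (toC x - z) ^+ 2 + complex.Im (toC x - z) ^+ 2) =
  (fun x => (x.1 - complex.Re z) ^+ 2 + (x.2 - complex.Im z) ^+ 2).
  by apply/funext => x; rewrite ReB ImB.
by apply: measurable_funD; apply: measurable_funX; exact: measurable_funB.
Qed.

Lemma measurable_disc (z : R[i]) (e : R) : measurable (disc z e).
Proof.
have -> : disc z e = setT `&`
    (fun x : R * R => cabs (toC x - z)) @^-1` `]-oo, e[.
  by rewrite setTI; apply/seteqP; split => x /=; rewrite in_itv.
by apply: measurable_cabsB => //; exact: measurable_itv.
Qed.

(* Every point off the support lies in a null disc with rational centre and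
   radius 1 / (n + 1), so countably many null discs cover the complement. *)
Lemma csupp_ae : \forall x \ae mu, csupp mu (toC x).
Proof.
pose D (t : rat * rat * nat) := disc (ratr t.1.1 +i* ratr t.1.2) t.2.+1%:R^-1.
(* The set [N i] is empty when [i] codes no triple or codes a disc of positive measure, so every
   [N i] is negligible. *)
pose N i := if unpickle i is Some t then [set x | D t x /\ mu (D t) = 0%E]
            else set0.
have inN x t : D t x -> mu (D t) = 0%E -> (\bigcup_i N i) x.
  by move=> Dx D0; exists (pickle t); [exact: I | rewrite /N pickleK].
apply: (@negligibleS _ _ _ mu (\bigcup_i N i)); last first.
  apply: negligible_bigcup => i; rewrite /N.
  case: (unpickle i) => [t|]; last exact: negligible_set0.
  have [t0|t0] := pselect (mu (D t) = 0%E).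
    exists (D t); split => //; first exact: measurable_disc.
    by move=> x [].
  exists set0; split => //.
  by move=> x [].
move=> x /= /existsNP[e /not_implyP[e0 /negP]]; rewrite -leNgt => me.
(* With 2 r <= e, any disc of radius [r] that contains [x] lies in the null disc of radius [e] about
   [x]. *)
have [r [n rE] [r0 ne]] : exists2 r : R,
    exists n, n.+1%:R^-1 = r & 0 < r /\ 2 * r <= e.
  have [n hn] := ltr_add_invr (@divr_gt0 _ e 2 e0 (ltr0Sn _ 1)).
  exists n.+1%:R^-1; first by exists n.
  split; first by rewrite invr_gt0 ltr0n.
  by rewrite mulrC -ler_pdivlMr ?ltW //; move: hn; rewrite add0r.
have near (y : R) : exists q : rat, `|y - ratr q| < r / 2.
  have [q] := @rat_in_itvoo R (y - r / 2) (y + r / 2) ltac:(lra).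
  by rewrite in_itv /= => /andP[? ?]; exists q; rewrite ltr_norml; lra.
have [[q1 h1] [q2 h2]] := (near x.1, near x.2).
pose c : R[i] := ratr q1 +i* ratr q2.
have xc : cabs (toC x - c) < r.
  apply: (le_lt_trans (cabs_le_ReIm _ _)); rewrite ReB ImB /=; lra.
apply: (inN _ (q1, q2, n)); first by rewrite /D /= rE.
apply: (@subset_measure0 _ _ _ mu _ (disc (toC x) e)).
- exact: measurable_disc.
- exact: measurable_disc.
- move=> y; rewrite /D /disc /= -/c rE => yc.
  have -> : toC y - toC x = (toC y - c) + - (toC x - c).
    by rewrite opprB addrA subrK.
  by apply: (le_lt_trans (cabsD _ _ _)); rewrite cabsN; lra.
- by apply/eqP; rewrite eq_le me measure_ge0.
Qed.

End Support.

(** * Integrability from finite moments *)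

Section PolynomialGrowth.
Variable R : realType.
Implicit Types f g : R * R -> R[i].

(** Bounding by a polynomial in the modulus makes the class stable under sums, products and
    conjugation, and finite moments make its members integrable. *)
Definition poly_growth f :=
  [/\ measurable_fun setT (fun x => complex.Re (f x)),
      measurable_fun setT (fun x => complex.Im (f x))
    & exists Q : {poly R}, forall x, cabs (f x) <= Q.[cabs (toC x)]].

Lemma poly_growth_cst (c : R[i]) : poly_growth (fun=> c).
Proof.
split; try exact: measurable_cst.
by exists (cabs c)%:P => x; rewrite hornerC.
Qed.

Lemma poly_growth_toC : poly_growth (@toC R).
Proof.
split; [exact: measurable_fst | exact: measurable_snd |].
by exists 'X => x; rewrite hornerX.
Qed.

Lemma poly_growthD f g : poly_growth f -> poly_growth g ->
  poly_growth (fun x => f x + g x).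
Proof.
move=> [f1 f2 [Q fQ]] [g1 g2 [P gP]]; split.
- rewrite (_ : (fun x => _) = (fun x => complex.Re (f x) + complex.Re (g x))).
    exact: measurable_funD.
  by apply/funext => x; case: (f x) => ? ?; case: (g x).
- rewrite (_ : (fun x => _) = (fun x => complex.Im (f x) + complex.Im (g x))).
    exact: measurable_funD.
  by apply/funext => x; case: (f x) => ? ?; case: (g x).
- exists (Q + P) => x; rewrite hornerD.
  by apply: (le_trans (cabsD _ _ _)); exact: lerD.
Qed.

Lemma poly_growthM f g : poly_growth f -> poly_growth g ->
  poly_growth (fun x => f x * g x).
Proof.
move=> [f1 f2 [Q fQ]] [g1 g2 [P gP]]; split.
- rewrite (_ : (fun x => _) = (fun x => complex.Re (f x) * complex.Re (g x) -
                                        complex.Im (f x) * complex.Im (g x))).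
    by apply: measurable_funB; exact: measurable_funM.
  by apply/funext => x; case: (f x) => ? ?; case: (g x).
- rewrite (_ : (fun x => _) = (fun x => complex.Re (f x) * complex.Im (g x) +
                                        complex.Im (f x) * complex.Re (g x))).
    by apply: measurable_funD; exact: measurable_funM.
  by apply/funext => x; case: (f x) => ? ?; case: (g x).
- exists (Q * P) => x; rewrite hornerM cabsM.
  by apply: ler_pM => //; exact: cabs_ge0.
Qed.

Lemma poly_growthJ f : poly_growth f -> poly_growth (fun x => (f x)^*).
Proof.
move=> [f1 f2 [Q fQ]]; split.
- rewrite (_ : (fun x => _) = (fun x => complex.Re (f x))) //.
  by apply/funext => x; case: (f x).
- rewrite (_ : (fun x => _) = (fun x => - complex.Im (f x))).
    exact: measurable_funN.
  by apply/funext => x; case: (f x).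
- by exists Q => x; rewrite cabsJ.
Qed.

Lemma poly_growth_horner (p : {poly R[i]}) : poly_growth (fun x => p.[toC x]).
Proof.
elim/poly_ind: p => [|p c IH].
  under [X in poly_growth X]eq_fun do rewrite horner0.
  exact: poly_growth_cst.
under [X in poly_growth X]eq_fun do rewrite hornerMXaddC.
apply: poly_growthD; last exact: poly_growth_cst.
by apply: poly_growthM => //; exact: poly_growth_toC.
Qed.

Variable mu : probability (R * R)%type R.
Hypothesis moments :
  forall n : nat, (\int[mu]_x ((cabs (toC x)) ^+ n)%:E < +oo)%E.

Lemma integrable_cabs_horner (Q : {poly R}) :
  mu.-integrable setT (fun x => (Q.[cabs (toC x)])%:E).
Proof.
rewrite (_ : (fun x => _) =
    (fun x => \sum_(i < size Q) ((Q`_i)%:E * (cabs (toC x) ^+ i)%:E))%E);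
  last first.
  by apply/funext => x; rewrite horner_coef -sumEFin.
apply: integrable_sum => //= i _; apply: integrableZl => //.
apply/integrableP; split.
  apply/measurable_EFinP; apply: measurable_funX.
  by have := measurable_cabsB R 0; under eq_fun do rewrite subr0.
under eq_integral do rewrite /= ger0_norm ?exprn_ge0 ?cabs_ge0 //.
exact: moments.
Qed.

Lemma integrable_Re_poly_growth f : poly_growth f ->
  mu.-integrable setT (fun x => (complex.Re (f x))%:E).
Proof.
move=> [f1 _ [Q fQ]].
apply: (le_integrable _ _ _ (integrable_cabs_horner Q)) => //.
  exact/measurable_EFinP.
move=> x _; rewrite /= lee_fin.
apply: (le_trans (ler_Re_cabs _ _)); apply: (le_trans (fQ x)).
exact: ler_norm.
Qed.

End PolynomialGrowth.

(** * Polynomials vanishing on the support *)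

Section Zeros.
Variable R : realType.

Lemma cabs_horner_le (p : {poly R[i]}) (M : R) (z : R[i]) : cabs z <= M ->
  cabs p.[z] <= \sum_(i < size p) cabs p`_i * M ^+ i.
Proof.
move=> zM; rewrite horner_coef.
apply: (big_ind2 (fun a b => cabs a <= b)) => [|a b c d ab cd|i _].
- by rewrite cabs0.
- by apply: (le_trans (cabsD _ _ _)); exact: lerD.
- rewrite cabsM ler_wpM2l ?cabs_ge0 //.
  have -> : cabs (z ^+ i) = cabs z ^+ i.
    by apply: complexI; rewrite rmorphXn /= !cabs_normc normrX.
  by rewrite lerXn2r // nnegrE ?cabs_ge0 // (le_trans (cabs_ge0 _ z)).
Qed.

(** Factor p(w) - p(z) = q(w) (w - z) and bound [q] on the unit disc about [z]; close to [z] the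
    difference is then smaller than |p(z)|. *)
Lemma horner_neq0_disc (p : {poly R[i]}) (z : R[i]) : p.[z] != 0 ->
  exists2 e : R, 0 < e & forall w, cabs (w - z) < e -> p.[w] != 0.
Proof.
move=> pz.
have /factor_theorem[q pq] : root (p - p.[z]%:P) z.
  by rewrite /root !hornerE subrr.
pose M := \sum_(i < size q) cabs q`_i * (cabs z + 1) ^+ i.
have M0 : 0 <= M.
  apply: sumr_ge0 => i _.
  by rewrite mulr_ge0 ?exprn_ge0 ?addr_ge0 ?cabs_ge0.
have c0 : 0 < cabs p.[z] by rewrite lt_neqAle cabs_ge0 eq_sym cabs_eq0 pz.
have M1 : 0 < M + 1 by rewrite ltr_wpDl.
(* The 1 keeps [w] where [M] bounds [q]; dividing by [M + 1] allows for M = 0. *)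
exists (Num.min 1 (cabs p.[z] / (M + 1))).
  by rewrite lt_min ltr01 divr_gt0.
move=> w; rewrite lt_min ltr_pdivlMr // => /andP[w1 wc].
apply/eqP => pw.
have : (p - p.[z]%:P).[w] = (q * ('X - z%:P)).[w] by rewrite pq.
rewrite !hornerE pw sub0r => /(congr1 (@cabs R)); rewrite cabsN cabsM => E.
have wM : cabs w <= cabs z + 1.
  have := cabsD _ (w - z) z; rewrite subrK => /le_trans; apply.
  by rewrite addrC lerD2l ltW.
have := cabs_horner_le q _ _ wM; rewrite -/M => qM.
have := cabs_ge0 _ (w - z); have := cabs_ge0 _ q.[w]; nra.
Qed.

(** A nonzero value at [z] would persist on a disc about [z], which has positive measure as [z] is
    in the support. *)
Lemma csupp_root (mu : probability (R * R)%type R) (p : {poly R[i]}) :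
  (\forall x \ae mu, p.[toC x] = 0) -> forall z, csupp mu z -> root p z.
Proof.
move=> p0 z zs; apply/negPn/negP => /horner_neq0_disc[e e0 he].
have := zs _ e0; rewrite -/(disc R z e) lt0e => /andP[/eqP + _]; apply.
apply/negligibleP; first exact: measurable_disc.
by apply: negligibleS p0 => x /he /eqP.
Qed.

End Zeros.

(** * Nonnegative functions with zero integral *)

Lemma ae_eq0_of_Rintegral_eq0 (d : measure_display) (T : measurableType d)
  (R : realType) (mu : {measure set T -> \bar R}) (f : T -> R) :
  mu.-integrable setT (EFin \o f) -> (\forall x \ae mu, 0 <= f x) ->
  Rintegral mu setT f = 0 -> \forall x \ae mu, f x = 0.
Proof.
move=> fi f0 If.
have mf := measurable_int _ fi.
have : ae_eq mu setT (EFin \o f) (cst 0%E).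
  apply/ae_eq_integral_abs => //.
  rewrite -(ae_eq_integral (abse \o (EFin \o f)) (EFin \o f)) //.
  (* [Rintegral] sends an infinite integral to 0 as well; integrability excludes that case. *)
  - by rewrite -[LHS](fineK (integrable_fin_num measurableT fi)); congr EFin.
  - exact: measurableT_comp.
  - by apply: filterS f0 => x fx _ /=; rewrite ger0_norm.
by apply: filterS => x /(_ I) [].
Qed.

(** * Orthogonality argument and root count *)

Theorem theoremA2p4 (R : realType) (mu : probability (R * R)%type R)
  (hmom : forall n : nat, (\int[mu]_x ((cabs (toC x)) ^+ n)%:E < +oo)%E)
  (z0 : R[i]) (hpure : (0 < mu (@toC R @^-1` [set z0]))%E)
  (delta : R) (hdelta : 0 < delta)
  (hdist : forall w, cvh (csupp mu `\` [set z0]) w -> delta <= cabs (z0 - w)) :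
  forall (n : nat) (Phi : {poly R[i]}),
    (exists s : seq R[i], uniq s /\ size s = n /\ (forall z, z \in s -> csupp mu z)) ->
    is_monic_OP mu n Phi ->
    forall z1 z2 : R[i],
      cabs (z1 - z0) < delta / 2 -> cabs (z2 - z0) < delta / 2 ->
      ~ (('X - z1%:P) * ('X - z2%:P) %| Phi).
Proof.
move=> n Phi [s [us [sn sS]]] [Pmon [Psz Porth]] z1 z2 h1 h2 dvd.
have [v v1 vsep] := convex_hull_separation _ _ z0 delta hdelta hdist.
(* Divisibility by the product also covers a double zero z1 = z2. *)
have [p PhiE] : exists p, Phi = p * (('X - z1%:P) * ('X - z2%:P)).
  by exists (Phi %/ (('X - z1%:P) * ('X - z2%:P))); rewrite divpK.
have p0 : p != 0.
  apply: contraTneq Pmon => p0.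
  by rewrite PhiE p0 mul0r monicE lead_coef0 eq_sym oner_eq0.
pose W := p * ('X - z0%:P).
have W0 : W != 0 by rewrite mulf_neq0 // polyXsubC_eq0.
(* [size] is the degree plus one: [W] trades two linear factors of [Phi] for one, so its degree is n
   - 1 and it is an admissible test polynomial. *)
have szW : size W = n.
  have : size Phi = (size p).+2.
    rewrite PhiE mulrA !size_Mmonic ?monicXsubC ?mulf_neq0 ?polyXsubC_eq0 //.
    by rewrite !size_XsubC !addn2.
  rewrite Psz => -[->]; rewrite size_Mmonic ?monicXsubC //.
  by rewrite size_XsubC addn2.
have v0 : v != 0 by rewrite -cabs_eq0 v1 oner_eq0.
have := Porth (v *: W); rewrite size_scale // szW leqnn => /(_ isT).
move=> /(congr1 (@complex.Re R)); rewrite /pinner /cint /=.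
set F := fun x => complex.Re _ => IF.
have FE x : F x =
    complex.Re ((toC x - z1) * (toC x - z2) * (v * (toC x - z0))^*) *
    cabs p.[toC x] ^+ 2.
  rewrite /F PhiE /W hornerZ !hornerM !hornerXsubC.
  have -> : p.[toC x] * ((toC x - z1) * (toC x - z2)) *
      (v * (p.[toC x] * (toC x - z0)))^* =
      ((toC x - z1) * (toC x - z2) * (v * (toC x - z0))^*) *
        (cabs p.[toC x] ^+ 2)%:C.
    by rewrite rmorphXn /= cabs_normc sqr_normc !rmorphM /=; ring.
  exact: Re_mul_real.
have Fpos x : csupp mu (toC x) -> toC x != z0 ->
    0 < complex.Re ((toC x - z1) * (toC x - z2) * (v * (toC x - z0))^*).
  move=> xs /eqP xz.
  have -> : toC x - z1 = (toC x - z0) - (z1 - z0) by rewrite opprB addrA subrK.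
  have -> : toC x - z2 = (toC x - z0) - (z2 - z0) by rewrite opprB addrA subrK.
  by apply: (@rotated_half_plane_pos R delta) => //; apply: vsep.
(* [F] is nonnegative on the support: it vanishes at [z0] and is a positive factor times |p|^2
   elsewhere. *)
have F0 : \forall x \ae mu, F x = 0.
  apply: ae_eq0_of_Rintegral_eq0 IF.
    apply: integrable_Re_poly_growth => //; apply: poly_growthM.
      exact: poly_growth_horner.
    by apply: poly_growthJ; exact: poly_growth_horner.
  apply: filterS (csupp_ae R mu) => x xs; rewrite FE.
  have [->|xz] := eqVneq (toC x) z0.
    by rewrite subrr mulr0 rmorph0 mulr0 mul0r.
  by rewrite mulr_ge0 ?sqr_ge0 // ltW // Fpos.
(* At [z0] the linear factor of [W] vanishes; at other support points F = 0 forces p = 0. *)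
have Wae : \forall x \ae mu, W.[toC x] = 0.
  apply: filterS2 F0 (csupp_ae R mu) => x + xs.
  rewrite FE /W hornerM hornerXsubC.
  have [->|xz] := eqVneq (toC x) z0; first by move=> _; rewrite subrr mulr0.
  move=> /eqP; rewrite mulf_eq0 gt_eqF ?Fpos //= sqrf_eq0 cabs_eq0 => /eqP ->.
  by rewrite mul0r.
(* The [n] distinct points of [s] would be roots of a nonzero polynomial of size [n], giving n <
   n. *)
have := max_poly_roots W0 _ us; rewrite szW sn ltnn.
suff -> : all (root W) s by move=> /(_ isT).
by apply/allP => z /sS; exact: (csupp_root _ _ _ Wae).
Qed.
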